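(* Let $a\in\mathbb{R}$, let $1<\nu<2$, and let $f:\mathbb{N}_{a-1}\to\mathbb{R}$. If $\nabla_{a-1}^{\nu} f(t)\ge 0$ for each $t\in\mathbb{N}_a$, then $\nabla f(t)\ge 0$ for all $t\in\mathbb{N}_{a+1}$; in particular, $f$ is nondecreasing on $\mathbb{N}_{a+1}$.
   Context: For a real number $c$, $\mathbb{N}_c=\{c,c+1,c+2,\dots\}$. $\nabla f(t)=f(t)-f(t-1)$, $\nabla^m=\nabla(\nabla^{m-1})$, $\rho(s)=s-1$. The rising function is $x^{\overline{\beta}}=\Gamma(x+\beta)/\Gamma(x)$. The nabla left fractional sum of order $\beta>0$ starting from $c$ is $\nabla_c^{-\beta}f(t)=\frac{1}{\Gamma(\beta)}\sum_{s=c+1}^{t}(t-\rho(s))^{\overline{\beta-1}}f(s)$, with empty sums equal to $0$. The nabla left (Riemann) fractional difference of noninteger order $\nu>0$ starting from $c$, with $n=[\nu]+1$ ($[\nu]$ the integer part), is $\nabla_c^{\nu}f(t)=\nabla^n\nabla_c^{-(n-\nu)}f(t)$ for $t\in\mathbb{N}_{c+1}$; equivalently, $\nabla_c^{\nu}f(t)=\frac{1}{\Gamma(-\nu)}\sum_{s=c+1}^{t}(t-\rho(s))^{\overline{-\nu-1}}f(s)$ for $t\in\mathbb{N}_{c+1}$. Here it is used with $c=a-1$. *)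

(* Defs.v *)
From mathcomp Require Import all_boot all_order all_algebra.
From mathcomp Require Import all_classical all_reals all_analysis.

Set Implicit Arguments.
Unset Strict Implicit.
Unset Printing Implicit Defensive.

Import Order.TTheory GRing.Theory Num.Theory.

Local Open Scope classical_set_scope.
Local Open Scope ring_scope.

(* {c, c + 1, c + 2, ...}. A function on this set is represented by a total
   function R -> R; its values elsewhere play no role in the operators below. *)
Definition natshift (R : realType) (c : R) : set R :=
  [set t | exists k : nat, t = c + k%:R].

(* \sum_(s = c)^t F s, with s running through c, c + 1, ..., t.
   Num.truncn vanishes on negative reals, so the sum is empty for t < c. *)
Definition shift_sum (R : realType) (c t : R) (F : R -> R) : R :=
  \sum_(0 <= k < Num.truncn (t - c + 1)) F (c + k%:R).

Definition nabla (R : realType) (f : R -> R) : R -> R :=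
  fun t => f t - f (t - 1).

Definition rho (R : realType) (s : R) : R := s - 1.

(* Euler's integral; it is the Gamma function for 0 < x. *)
Definition Gamma_integral (R : realType) (x : R) : R :=
  \int[lebesgue_measure]_(u in `]0, +oo[) (u `^ (x - 1) * expR (- u)).

(* For x <= 0, the extension by Gamma (x + 1) = x * Gamma x: n is the least
   natural number with 0 < x + n. At the poles 0, -1, -2, ... the denominator
   vanishes, so that Gamma x = 0 and hence (Gamma x)^-1 = 0, the usual
   convention for the reciprocal. *)
Definition Gamma (R : realType) (x : R) : R :=
  let n := if 0 < x then 0%N else (Num.truncn (- x)).+1 in
  Gamma_integral (x + n%:R) / \prod_(0 <= i < n) (x + i%:R).

Definition rising (R : realType) (x beta : R) : R :=
  Gamma (x + beta) / Gamma x.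

Definition nabla_fsum (R : realType) (c beta : R) (f : R -> R) : R -> R :=
  fun t => (Gamma beta)^-1 *
    shift_sum (c + 1) t (fun s => rising (t - rho s) (beta - 1) * f s).

(* The Riemann left difference; Num.truncn nu is the integer part of nu > 0.
   For t close to c the outer differences evaluate the fractional sum at
   points below c + 1, where it is an empty sum. *)
Definition nabla_fdiff (R : realType) (c nu : R) (f : R -> R) : R -> R :=
  let n := (Num.truncn nu).+1 in
  iter n (@nabla R) (nabla_fsum c (n%:R - nu) f).

(* Main.v *)
(* Extend f by 0 to the left of a and let D be its backward difference, so that
   D(a) = f(a). With h_j = rising (j + 1) (1 - nu), a constant multiple of the
   coefficients of (1 - x)^(nu - 2), one has
     Gamma(2 - nu) * nabla^nu f(a + m)
       = h_0 D(a + m) - \sum_(k < m) (h_(m-1-k) - h_(m-k)) D(a + k).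
   As h_0 > 0 and h is nonincreasing, D >= 0 follows by strong induction on m.
   The monotonicity of h is the inequality
     Gamma(x + 1) / Gamma(x) <= Gamma(y + 1) / Gamma(y)  for 0 < x <= y. *)
Require Import Defs.
From mathcomp Require Import all_boot all_order all_algebra.
From mathcomp Require Import all_classical all_reals all_analysis.
From mathcomp Require Import measurable_realfun ring lra.

Set Implicit Arguments.
Unset Strict Implicit.
Unset Printing Implicit Defensive.

Import Order.TTheory GRing.Theory Num.Theory numFieldNormedType.Exports.

Local Open Scope classical_set_scope.
Local Open Scope ring_scope.

(** * The integrand of Euler's integral *)

Definition gamma_density (R : realType) (x u : R) : R :=
  u `^ (x - 1) * expR (- u).

Lemma gamma_density_gt0 (R : realType) (x u : R) :
  0 < u -> 0 < gamma_density x u.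
Proof. by move=> u0; rewrite mulr_gt0 ?powR_gt0 ?expR_gt0. Qed.

Lemma measurable_gamma_density (R : realType) (x : R) (A : set R) :
  measurable_fun A (gamma_density x).
Proof.
apply: measurable_funTS; apply: measurable_funM => //.
by apply: measurableT_comp => //; exact: measurable_funN.
Qed.

(** * An explicit majorant with bounded primitive *)

(** For u > 0 this is the derivative in u of -1 / (1 + u^x), or equally of u^x / (1 + u^x). *)
Definition sat_density (R : realType) (x u : R) : R :=
  (1 + u `^ x) ^- 2 * (x * u `^ (x - 1)).

Lemma derivable1_cvg (R : realType) (f : R -> R) (x : R) :
  derivable f x 1 -> f v @[v --> x] --> f x.
Proof. by move=> /derivable1_diffP/differentiable_continuous. Qed.

Lemma cvg_powR (R : realType) (b u : R) : 0 < u ->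
  v `^ b @[v --> u] --> u `^ b.
Proof.
move=> u0; apply/derivable1_cvg.
by apply: derivable_powR; rewrite in_itv/= andbT.
Qed.

Lemma onepowR_gt0 (R : realType) (x u : R) : 0 < 1 + u `^ x.
Proof. by rewrite ltr_pwDl ?powR_ge0. Qed.

Lemma is_derive_sat_primitive (R : realType) (x u : R) : 0 < u ->
  is_derive u 1 (fun v => - (1 + v `^ x)^-1) (sat_density x u).
Proof.
move=> u0.
have du := is_derive1_powR x u0.
have d1 : is_derive u 1 (fun v : R => 1 + v `^ x) (x * u `^ (x - 1)).
  by have := is_deriveD (is_derive_cst (1 : R) u 1) du; rewrite add0r.
have n0 : 1 + u `^ x != 0 by rewrite gt_eqF ?onepowR_gt0.
have d2 := @is_deriveV R _ u _ 1 n0 d1.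
have d3 := @is_deriveN _ _ _ _ _ _ _ d2.
by apply: (is_derive_eq d3); rewrite /sat_density scaleNr opprK.
Qed.

Lemma cvg_sat_density (R : realType) (x u : R) : 0 < u ->
  sat_density x v @[v --> u] --> sat_density x u.
Proof.
move=> u0; rewrite /sat_density.
apply: (@cvgM R); last first.
  by apply: cvgM; [exact: cvg_cst|exact: cvg_powR].
apply: (@cvgV R); first by rewrite expf_neq0// gt_eqF ?onepowR_gt0.
have cu : 1 + v `^ x @[v --> u] --> 1 + u `^ x.
  by apply: cvgD; [exact: cvg_cst|exact: cvg_powR].
exact: (cvgM cu cu).
Qed.

Lemma sat_density_ge0 (R : realType) (x u : R) : 0 < x -> 0 <= sat_density x u.
Proof.
move=> x0.
rewrite mulr_ge0 ?invr_ge0 ?exprn_ge0 ?mulr_ge0 ?powR_ge0 ?(ltW x0)//.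
by rewrite ltW ?onepowR_gt0.
Qed.

Lemma measurable_sat_density (R : realType) (x : R) (A : set R) :
  measurable_fun A (sat_density x).
Proof.
(* Writing the inverse square as a real power makes the measurability of [powR] applicable. *)
have -> : sat_density x =
  (fun u => (1 + u `^ x) `^ (- 2) * (x * u `^ (x - 1))).
  apply/funext => u; rewrite /sat_density powR_invn//.
  by rewrite ltW ?onepowR_gt0.
apply: measurable_funTS; apply: measurable_funM => //; last first.
  by apply: measurable_funM.
apply: (@measurableT_comp _ _ _ _ _ _ (fun v : R => v `^ (-2))) => //.
by apply: measurable_funD.
Qed.

Lemma cvg_sat_primitive (R : realType) (x : R) : 0 < x ->
  - (1 + v `^ x)^-1 @[v --> +oo] --> (0 : R).
Proof.
move=> x0; rewrite -oppr0; apply: cvgN.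
apply/cvgrPdist_le => e e0; near=> v.
rewrite sub0r normrN ger0_norm; last by rewrite invr_ge0 ltW ?onepowR_gt0.
rewrite -[e]invrK lef_pV2 ?posrE ?onepowR_gt0 ?invr_gt0//.
(* Once v is at least (1/e)^(1/x), v^x is at least 1/e. *)
have h : (e^-1) `^ (x^-1) <= v.
  by near: v; apply: nbhs_pinfty_ge; rewrite num_real.
have -> : e^-1 = ((e^-1) `^ (x^-1)) `^ x.
  by rewrite -powRrM mulVf ?gt_eqF// powRr1// invr_ge0 ltW.
apply: (@le_trans _ _ (v `^ x)); last by rewrite lerDr.
by rewrite ge0_ler_powR ?nnegrE ?powR_ge0 ?(ltW x0)// (le_trans _ h) ?powR_ge0.
Unshelve. all: by end_near. Qed.

(** The fundamental theorem of calculus gives the value 1 / (1 + a^x). The bound 1 does not depend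
    on a, so it survives a -> 0, while a > 0 avoids the possible singularity of u^(x-1) at 0. *)
Lemma integral_sat_density_le1 (R : realType) (x a : R) : 0 < x -> 0 < a ->
  (\int[lebesgue_measure]_(u in `[a, +oo[) (sat_density x u)%:E <= 1%:E)%E.
Proof.
move=> x0 a0.
have lt0 u : a <= u -> 0 < u by exact: lt_le_trans.
rewrite (@ge0_continuous_FTC2y _ _ (fun v => - (1 + v `^ x)^-1) _ 0).
- rewrite -EFinB lee_fin sub0r opprK invf_le1 ?onepowR_gt0//.
  by rewrite lerDl powR_ge0.
- by move=> u _; exact: sat_density_ge0.
- apply: continuous_in_subspaceT => u; rewrite inE/= in_itv/= andbT => au.
  exact/cvg_sat_density/lt0.
- exact: cvg_sat_primitive.
- by move=> u /ltW/lt0 u0; have [] := is_derive_sat_primitive x u0.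
- apply: cvg_at_right_filter; apply: derivable1_cvg.
  by have [] := is_derive_sat_primitive x a0.
- move=> u; rewrite in_itv/= andbT => /ltW/lt0 u0.
  by rewrite derive1E; have [_ ->] := is_derive_sat_primitive x u0.
Qed.

(* Up to a constant, u^(x-1) e^(-u) is dominated by the derivative
   x u^(x-1) / (1 + u^x)^2 of the bounded function u^x / (1 + u^x). *)
Lemma gamma_density_le_sat_density (R : realType) (x : R) : 0 < x ->
  exists C : R, 0 <= C /\
    forall u, 0 < u -> gamma_density x u <= C * sat_density x u.
Proof.
move=> x0; pose n := (Num.truncn x).+1.
have xn : x <= n%:R by rewrite ltW// truncnS_gt.
(* From u^x <= 1 + u^n comes 1 + u^x <= 2 + u^n; the term of degree n in the exponential series
   gives u^n <= n! 2^n e^(u/2). *)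
pose K : R := 2 + n`!%:R * 2 ^+ n.
have K0 : 0 <= K by rewrite addr_ge0// mulr_ge0// exprn_ge0.
(* The exponent u/2 is chosen because squaring yields (1 + u^x)^2 <= K^2 e^u, which is the claim
   with C = K^2 / x. *)
have bound (u : R) : 0 < u -> 1 + u `^ x <= K * expR (u / 2).
  move=> u0.
  have e1 : 1 <= expR (u / 2) by rewrite -expR0 ler_expR divr_ge0// ltW.
  have e2 : u ^+ n <= n`!%:R * 2 ^+ n * expR (u / 2).
    have /(expR_ge1Dxn (Num.truncn x)) : 0 <= u / 2 by rewrite divr_ge0// ltW.
    rewrite -/n => h.
    have {}h : (u / 2) ^+ n / n`!%:R <= expR (u / 2).
      by apply: le_trans h; rewrite lerDr.
    rewrite ler_pdivrMr ?ltr0n ?fact_gt0// expr_div_n ler_pdivrMr ?exprn_gt0// in h.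
    by apply: (le_trans h); rewrite le_eqVlt; apply/predU1P; left; ring.
  have e3 : u `^ x <= 1 + u ^+ n.
    have [u1|u1] := leP u 1.
      apply: (@le_trans _ _ 1); last by rewrite lerDl exprn_ge0// ltW.
      have -> : (1 : R) = 1 `^ x by rewrite powR1.
      by rewrite ge0_ler_powR ?nnegrE// ltW.
    apply: (@le_trans _ _ (u ^+ n)); last by rewrite lerDr.
    by rewrite -powR_mulrn ?(ltW u0)// ler_powR// ltW.
  have -> : K * expR (u / 2) = 2 * expR (u / 2) + n`!%:R * 2 ^+ n * expR (u / 2).
    by rewrite mulrDl.
  lra.
exists (K ^+ 2 / x); split; first by rewrite divr_ge0 ?exprn_ge0// ltW.
move=> u u0.
have p0 : 0 < u `^ (x - 1) by rewrite powR_gt0.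
have q0 : 0 < 1 + u `^ x := onepowR_gt0 _ _.
have -> : K ^+ 2 / x * sat_density x u =
    u `^ (x - 1) * (K ^+ 2 / (1 + u `^ x) ^+ 2).
  by rewrite /sat_density; field; rewrite !gt_eqF.
rewrite /gamma_density ler_pM2l// expRN.
rewrite ler_pdivlMr ?exprn_gt0// mulrC ler_pdivrMr ?expR_gt0//.
have -> : expR u = expR (u / 2) ^+ 2 by rewrite -expRM_natl; congr expR; field.
by rewrite -exprMn lerXn2r ?nnegrE ?bound ?mulr_ge0 ?expR_ge0 ?(ltW q0).
Qed.

(** * Integrability of the integrand and positivity of Gamma *)

(** The half-lines from 1/(k+1) to infinity exhaust []0, +oo[]. On each of them the majorant bounds
    the integral by the same [C], and monotone convergence carries the bound to the union. *)
Lemma integrable_gamma_density (R : realType) (x : R) : 0 < x ->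
  lebesgue_measure.-integrable `]0%R, +oo[ (EFin \o gamma_density x).
Proof.
move=> x0; have [C [C0 hC]] := gamma_density_le_sat_density x0.
apply/integrableP; split.
  by apply/measurable_EFinP; exact: measurable_gamma_density.
under eq_integral => u.
  rewrite inE/= in_itv/= andbT => u0.
  rewrite ger0_norm; last by rewrite ltW// gamma_density_gt0.
  over.
apply: (@le_lt_trans _ _ C%:E); last by rewrite ltry.
rewrite itvoyEbigcup.
have sub k : `[(0 + k.+1%:R^-1 : R), +oo[ `<=` `]0%R, +oo[.
  move=> u /=; rewrite !in_itv/= !andbT add0r; apply: lt_le_trans.
  by rewrite invr_gt0.
pose F k := `[(0 + k.+1%:R^-1 : R), +oo[%classic.
have mf A : measurable_fun A (fun u => (gamma_density x u)%:E).
  by apply/measurable_EFinP; exact: measurable_gamma_density.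
have f0 k u : F k u -> (0 <= (gamma_density x u)%:E)%E.
  move=> /sub; rewrite /= in_itv/= andbT lee_fin => u0.
  by rewrite ltW ?gamma_density_gt0.
have ndF : nondecreasing_seq F.
  apply/nondecreasing_seqP => k; rewrite subsetEset => u.
  rewrite /F/= !in_itv/= !andbT !add0r.
  by apply: le_trans; rewrite lef_pV2 ?posrE// ler_nat.
have mF k : measurable (F k) by exact: measurable_itv.
have cv : (\int[lebesgue_measure]_(u in F k) (gamma_density x u)%:E)%E
    @[k --> \oo] --> (\int[lebesgue_measure]_(u in \bigcup_k F k) (gamma_density x u)%:E)%E.
  by apply: ge0_nondecreasing_set_cvg_integral => // k; exact: mf.
apply: cvge_le cv.
apply: nearW => k.
apply: (@le_trans _ _
  (\int[lebesgue_measure]_(u in F k) (C * sat_density x u)%:E)%E).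
  apply: ge0_le_integral => //.
  - exact: mF.
  - exact: f0.
  - exact: mf.
  - apply/measurable_EFinP; apply: measurable_funM => //.
    exact: measurable_sat_density.
  - by move=> u /sub; rewrite /= in_itv/= andbT lee_fin => /hC.
under eq_integral do rewrite EFinM.
rewrite ge0_integralZl//; last 3 first.
- exact: mF.
- by apply/measurable_EFinP; exact: measurable_sat_density.
- by move=> u _; rewrite lee_fin sat_density_ge0.
rewrite -[leRHS]mule1 lee_wpmul2l ?lee_fin//.
by apply: integral_sat_density_le1 => //; rewrite add0r invr_gt0.
Qed.

(** If the integral were 0, the positive density would vanish almost everywhere, and []0, +oo[]
    would be a null set. *)
Lemma Gamma_integral_gt0 (R : realType) (x : R) : 0 < x -> 0 < Gamma_integral x.
Proof.
move=> x0; rewrite lt_neqAle; apply/andP; split; last first.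
  by apply: Rintegral_ge0 => u _; rewrite mulr_ge0 ?powR_ge0 ?expR_ge0.
apply/negP => /eqP/esym G0.
have fint := integrable_gamma_density x0.
have mf : measurable_fun (`]0, +oo[ : set R) (EFin \o gamma_density x).
  by apply/measurable_EFinP; exact: measurable_gamma_density.
have mI : measurable (`]0%R, +oo[ : set (measurableTypeR R)).
  exact: measurable_itv.
have I0 : (\int[lebesgue_measure]_(u in `]0%R, +oo[)
    (gamma_density x u)%:E = 0)%E.
  have /fineK <- := integrable_fin_num mI fint.
  by congr EFin.
have [N [mN N0 sN]] : ae_eq (@lebesgue_measure R) `]0%R, +oo[%classic
    (EFin \o gamma_density x) (cst 0%E).
  apply/ae_eq_integral_abs => //.
  rewrite -[RHS]I0; apply: eq_integral => u; rewrite inE/= in_itv/= andbT => u0.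
  by rewrite ger0_norm// ltW// gamma_density_gt0.
have : (lebesgue_measure (`]0%R, +oo[ : set R) <= 0)%E.
  rewrite -N0; apply: le_measure; rewrite ?inE; [exact: mI|exact: mN|].
  move=> u u0; apply: sN => /= /(_ u0) [f0].
  move: u0; rewrite /= in_itv/= andbT => /(gamma_density_gt0 x).
  by rewrite f0 ltxx.
by rewrite lebesgue_measure_itv/= ltry.
Qed.

(** * Monotonicity of the ratio Gamma(x + 1) / Gamma(x) *)

Lemma Gamma_integralE (R : realType) (x : R) :
  Gamma_integral x = \int[lebesgue_measure]_(u in `]0, +oo[) gamma_density x u.
Proof. by []. Qed.

(* Chebyshev's association inequality in its simplest form: with
   c = Gamma (y + 1) / Gamma y, the factors u - c and u^(x - y) - c^(x - y)
   have opposite signs, so that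
   (u - c) u^(x-1) e^(-u) <= c^(x-y) (u - c) u^(y-1) e^(-u),
   and the right-hand side has integral 0. *)
Lemma Gamma_integral_ratio (R : realType) (x y : R) : 0 < x -> x <= y ->
  Gamma_integral (x + 1) * Gamma_integral y <=
  Gamma_integral x * Gamma_integral (y + 1).
Proof.
move=> x0 xy; have y0 := lt_le_trans x0 xy.
have Gy := Gamma_integral_gt0 y0.
have y10 : 0 < y + 1 by rewrite addr_gt0.
have x10 : 0 < x + 1 by rewrite addr_gt0.
pose c := Gamma_integral (y + 1) / Gamma_integral y.
have c0 : 0 < c by rewrite divr_gt0 ?Gamma_integral_gt0.
pose d := c `^ (x - y).
have d0 : 0 < d by rewrite powR_gt0.
have pt u : `]0, +oo[%classic u ->
    gamma_density (x + 1) u + d * c * gamma_density y u <=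
    c * gamma_density x u + d * gamma_density (y + 1) u.
  rewrite /= in_itv/= andbT => u0.
  rewrite /gamma_density !addrK.
  rewrite -{1}(mulr_powRB1 (ltW u0) x0) -(mulr_powRB1 (ltW u0) y0).
  have e : u `^ (x - 1) = u `^ (y - 1) * u `^ (x - y).
    by rewrite -powRD; [congr (_ `^ _); ring|rewrite (gt_eqF u0) implybT].
  rewrite e -subr_ge0.
  set p := u `^ (y - 1); set q := u `^ (x - y); set E := expR _.
  have -> : c * (p * q * E) + d * (u * p * E) -
      (u * (p * q) * E + d * c * (p * E)) =
    p * E * ((u - c) * (d - q)) by ring.
  apply: mulr_ge0; first by rewrite mulr_ge0 ?powR_ge0 ?expR_ge0.
  have anti (s t : R) : 0 < s -> s <= t -> t `^ (x - y) <= s `^ (x - y).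
    move=> s0 st; have t0 := lt_le_trans s0 st.
    rewrite -opprB !powRN lef_pV2 ?posrE ?powR_gt0//.
    by rewrite ge0_ler_powR ?nnegrE ?subr_ge0 ?(ltW s0) ?(ltW t0).
  have [uc|cu] := leP u c.
    by rewrite mulr_le0 ?subr_le0// anti.
  by rewrite mulr_ge0 ?subr_ge0 ?(ltW cu)// anti// ltW.
have mI : measurable (`]0%R, +oo[ : set (measurableTypeR R)).
  exact: measurable_itv.
have Ix := integrable_gamma_density x0.
have Iy := integrable_gamma_density y0.
have Ix1 := integrable_gamma_density x10.
have Iy1 := integrable_gamma_density y10.
have IZ (k z : R) : 0 < z -> lebesgue_measure.-integrable `]0%R, +oo[
    (EFin \o (fun u => k * gamma_density z u)).
  by move=> z0; exact: (integrableZl mI k (integrable_gamma_density z0)).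
have ID (f g : R -> R) : lebesgue_measure.-integrable `]0%R, +oo[ (EFin \o f) ->
    lebesgue_measure.-integrable `]0%R, +oo[ (EFin \o g) ->
    lebesgue_measure.-integrable `]0%R, +oo[
      (EFin \o (fun u : R => f u + g u : R)).
  by move=> If Ig; exact: (integrableD mI If Ig).
have := le_Rintegral mI (ID _ _ Ix1 (IZ (d * c) _ y0))
  (ID _ _ (IZ c _ x0) (IZ d _ y10)) pt.
rewrite !RintegralD ?RintegralZl//; try exact: IZ.
rewrite -!Gamma_integralE.
(* By the choice of [c] the two terms carrying [d] agree and cancel, leaving Gamma(x + 1) <= c
   Gamma(x). *)
have -> : d * c * Gamma_integral y = d * Gamma_integral (y + 1).
  by rewrite /c; field; rewrite gt_eqF.
rewrite lerD2r /c mulrAC ler_pdivlMr// => h.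
by rewrite (le_trans h)// mulrC.
Qed.

(** * Sign and monotonicity of the rising function *)

Lemma GammaE (R : realType) (x : R) : 0 < x -> Gamma x = Gamma_integral x.
Proof. by move=> x0; rewrite /Gamma x0 big_geq// addr0 divr1. Qed.

Lemma rising_gt0 (R : realType) (x b : R) :
  0 < x -> 0 < x + b -> 0 < rising x b.
Proof. by move=> x0 xb0; rewrite divr_gt0// GammaE// Gamma_integral_gt0. Qed.

(** After cross-multiplication this is the ratio inequality for the pair x + b <= x. *)
Lemma rising_nonincr (R : realType) (x b : R) : 0 < x + b -> b <= 0 ->
  rising (x + 1) b <= rising x b.
Proof.
move=> xb0 b0.
have xbx : x + b <= x by rewrite gerDl.
have x0 := lt_le_trans xb0 xbx.
have x10 : 0 < x + 1 by rewrite addr_gt0.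
rewrite /rising addrAC !GammaE ?(addr_gt0 xb0)//.
rewrite ler_pdivrMr ?Gamma_integral_gt0// mulrAC.
rewrite ler_pdivlMr ?Gamma_integral_gt0//.
exact: Gamma_integral_ratio.
Qed.

(** * Discrete convolutions and their differences *)

(** The convolution of [h] and [g] at index n - 1: [n] counts the terms, so [n = 0] gives the empty
    sum. *)
Definition conv_sum (R : pzRingType) (h g : nat -> R) (n : nat) : R :=
  \sum_(k < n) h (n.-1 - k)%N * g k.

(** The value at 0 corresponds to extending [g] by 0 to index -1. *)
Definition back_diff (R : zmodType) (g : nat -> R) (n : nat) : R :=
  if n is m.+1 then g m.+1 - g m else g 0%N.

(** Shifting k by one in the second sum aligns the kernels; the unmatched term with [g 0] is the
    value of [back_diff g] at 0. *)
Lemma back_diff_conv_sum (R : pzRingType) (h g : nat -> R) (n : nat) :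
  conv_sum h g n - conv_sum h g n.-1 = conv_sum h (back_diff g) n.
Proof.
case: n => [|n]; first by rewrite subrr /conv_sum big_ord0.
rewrite /conv_sum /= !big_ord_recl/= subn0 -addrA; congr (_ + _).
rewrite -sumrB; apply: eq_bigr => k _.
by rewrite mulrBr /bump/= add1n -subn1 -subnDA add1n.
Qed.

Lemma back_diff_ge0 (R : numFieldType) (h g : nat -> R) :
  0 < h 0%N -> (forall n, h n.+1 <= h n) ->
  (forall n, 0 <= conv_sum h g n.+1 - conv_sum h g n -
    (conv_sum h g n - conv_sum h g n.-1)) ->
  forall n, 0 <= back_diff g n.
Proof.
move=> h0 hdec hc; elim/ltn_ind => n IH.
(* The second difference for [g] becomes a first difference for [back_diff g], from which the top
   term [h 0 * back_diff g n] is split off. *)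
have := hc n; rewrite back_diff_conv_sum (back_diff_conv_sum h g n.+1).
rewrite /conv_sum big_ord_recr/= subnn addrAC -sumrB => hn.
have {}hn : \sum_(k < n) (h (n.-1 - k)%N - h (n - k)%N) * back_diff g k <=
    h 0%N * back_diff g n.
  rewrite -subr_ge0 (le_trans hn)// le_eqVlt; apply/predU1P; left.
  rewrite addrC -sumrN; congr (_ + _); apply: eq_bigr => k _.
  by rewrite -mulrBl -mulNr opprB.
rewrite -(pmulr_rge0 _ h0); apply: le_trans hn; apply: sumr_ge0 => k _.
rewrite mulr_ge0 ?IH// subr_ge0.
(* As k < n, n - k is the successor of n - 1 - k, and the monotonicity of [h] applies. *)
by case: n k {IH} => [[]//|n] k; rewrite subSn// -ltnS.
Qed.

(** * Fractional sums and differences as convolutions *)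

(** For t = a + n - 1 and s = a + k with k < n, t - rho(s) = (n - 1 - k) + 1. *)
Lemma nabla_fsum_conv_sum (R : realType) (a beta : R) (f : R -> R) (n : nat) :
  nabla_fsum (a - 1) beta f (a + n%:R - 1) =
  (Gamma beta)^-1 * conv_sum (fun j => rising (j%:R + 1) (beta - 1))
                         (fun k => f (a + k%:R)) n.
Proof.
rewrite /nabla_fsum /shift_sum subrK; congr (_ * _).
have -> : a + n%:R - 1 - a + 1 = n%:R :> R by ring.
rewrite natrK big_mkord; apply: eq_bigr => k _.
have -> : (n.-1 - k)%N = (n - k.+1)%N by rewrite -subn1 -subnDA add1n.
suff -> : a + n%:R - 1 - rho (a + k%:R) = (n - k.+1)%:R + 1 by [].
by rewrite /rho natrB// -natr1; ring.
Qed.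

Lemma nabla_fsum_lt (R : realType) (a beta t : R) (f : R -> R) :
  t < a -> nabla_fsum (a - 1) beta f t = 0.
Proof.
move=> ta; rewrite /nabla_fsum /shift_sum subrK big_geq ?mulr0//.
by rewrite truncn_le_nat; lra.
Qed.

(** The integer part of [nu] is 1, so the operator is the second difference of the sum of order 2 -
    nu, evaluated at a + n, a + n - 1 and a + n - 2. *)
Lemma nabla_fdiff_conv_sum (R : realType) (a nu : R) (f : R -> R) (n : nat) :
  1 < nu -> nu < 2 ->
  let C := conv_sum (fun j => rising (j%:R + 1) (1 - nu))
    (fun k => f (a + k%:R)) in
  nabla_fdiff (a - 1) nu f (a + n%:R) =
  (Gamma (2 - nu))^-1 * (C n.+1 - C n - (C n - C n.-1)).
Proof.
move=> nu1 nu2 C; rewrite /nabla_fdiff (_ : Num.truncn nu = 1%N); last first.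
  by apply: truncn_def; rewrite (ltW nu1).
have S m : nabla_fsum (a - 1) (2 - nu) f (a + m%:R - 1) =
    (Gamma (2 - nu))^-1 * C m.
  by rewrite nabla_fsum_conv_sum (_ : 2 - nu - 1 = 1 - nu)//; ring.
rewrite /= /nabla.
have -> : a + n%:R = a + n.+1%:R - 1 by rewrite -natr1; ring.
rewrite S (_ : a + n.+1%:R - 1 - 1 = a + n%:R - 1); last first.
  by rewrite -natr1; ring.
rewrite S.
have -> : nabla_fsum (a - 1) (2 - nu) f (a + n%:R - 1 - 1) =
    (Gamma (2 - nu))^-1 * C n.-1.
  (* For [n = 0] the point is a - 2, where the fractional sum is empty; [C 0.-1] is [C 0], which is
     also 0. *)
  case: n => [|n] /=.
    by rewrite nabla_fsum_lt ?/C/conv_sum ?big_ord0 ?mulr0//; lra.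
  by rewrite -S; congr nabla_fsum; rewrite -natr1; ring.
by rewrite !mulrBr.
Qed.

Theorem theorem2p3 (R : realType) (a nu : R) (f : R -> R)
    (hnu1 : 1 < nu) (hnu2 : nu < 2)
    (hf : forall t : R, natshift a t -> 0 <= nabla_fdiff (a - 1) nu f t) :
  (forall t : R, natshift (a + 1) t -> 0 <= nabla f t) /\
  (forall s t : R, natshift (a + 1) s -> natshift (a + 1) t ->
     s <= t -> f s <= f t).
Proof.
have D n : 0 <= back_diff (fun k => f (a + k%:R)) n.
  apply: (@back_diff_ge0 _ (fun j => rising (j%:R + 1) (1 - nu))) => [|j|m].
  (* Here h_0 = Gamma(2 - nu) / Gamma(1), and 2 - nu > 0. *)
  - by apply: rising_gt0; lra.
  - have j0 : 0 <= j%:R :> R by [].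
    by rewrite -natr1; apply: rising_nonincr; lra.
  - have /hf : natshift a (a + m%:R) by exists m.
    rewrite nabla_fdiff_conv_sum// pmulr_rge0//.
    by rewrite invr_gt0 GammaE ?Gamma_integral_gt0//; lra.
(* The step from a + 1 + k to a + 2 + k is the difference of index k + 2, counted from [a]. *)
have mono k : f (a + 1 + k%:R) <= f (a + 1 + k.+1%:R).
  rewrite -subr_ge0; have := D k.+2; rewrite /= -!natr1.
  by congr (0 <= f _ - f _); ring.
split=> [_ [k ->]|_ _ [k ->] [l ->]].
  have := D k.+1; rewrite /nabla /= -natr1.
  by congr (0 <= f _ - f _); ring.
rewrite lerD2l ler_nat; exact: (homo_leq (@lexx _ R) (@le_trans _ R) mono).
Qed.
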